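(* Every planar graph $G$ with $n$ vertices and $m\geq 3$ edges satisfies $c(G)\leq n+\frac{7}{3}m-2$.
   Context: All graphs are finite, simple and undirected. A clique of a graph $G$ is a (possibly empty) set of pairwise adjacent vertices; $c(G)$ denotes the number of cliques of $G$ (including the empty clique, all single vertices and all edges). *)

(* Defs.v *)
From HB Require Import structures.
From mathcomp Require Import all_boot all_order all_algebra.
From mathcomp Require Import all_classical all_reals all_analysis.
From mathcomp Require Import Rstruct Rstruct_topology.
Set Implicit Arguments. Unset Strict Implicit. Unset Printing Implicit Defensive.
Import Order.TTheory GRing.Theory Num.Theory.
Local Open Scope ring_scope.

(* A finite simple graph: vertex type T : finType, adjacency e : rel T,
   assumed symmetric and irreflexive (hypotheses of the theorem). *)

Definition edges (T : finType) (e : rel T) : {set {set T}} :=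
  [set A : {set T} | [exists x, exists y, e x y && (A == [set x; y])]].

Definition is_clique (T : finType) (e : rel T) (A : {set T}) : bool :=
  [forall x in A, forall y in A, (x != y) ==> e x y].

(* c(G): number of cliques, including the empty clique. *)
Definition num_cliques (T : finType) (e : rel T) : nat :=
  #|[set A : {set T} | is_clique e A]|.

Local Open Scope classical_set_scope.

Definition plane := (Rdefinitions.R * Rdefinitions.R)%type.

Definition unit_interval : set Rdefinitions.R :=
  [set t : Rdefinitions.R | (0 <= t <= 1)%R].
Definition open_unit_interval : set Rdefinitions.R :=
  [set t : Rdefinitions.R | (0 < t < 1)%R].

(* Planarity: a drawing in the plane where vertices are distinct points and
   every edge xy is a simple arc (continuous injective image of [0,1]) from
   x to y, whose interior avoids all vertex points and the interiors of the
   arcs of all other edges.  (arc x y is the arc used for the edge {x,y};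
   arcs are required for both orientations, which is harmless.) *)
Definition planar (T : finType) (e : rel T) : Prop :=
  exists (pos : T -> plane) (arc : T -> T -> Rdefinitions.R -> plane),
    injective pos /\
    forall x y, e x y ->
      [/\ {within unit_interval, continuous (arc x y)},
          arc x y 0 = pos x /\ arc x y 1 = pos y,
          {in unit_interval &, injective (arc x y)},
          (forall t z, open_unit_interval t -> arc x y t <> pos z) &
          (forall u v t s, e u v -> ([set x; y] != [set u; v])%SET ->
             open_unit_interval t -> open_unit_interval s ->
             arc x y t <> arc u v s)].

(* Main.v *)
Require Import Defs.
From HB Require Import structures.
From mathcomp Require Import all_boot all_order all_algebra.
From mathcomp Require Import zify lra.
From mathcomp Require all_classical all_reals all_analysis Rstruct Rstruct_topology.
From Stdlib Require Import Btauto.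
Set Implicit Arguments. Unset Strict Implicit. Unset Printing Implicit Defensive.
Import Order.TTheory GRing.Theory Num.Theory.

(* Induction on the vertex set. If some triangle C separates G, then G is the
   union of two proper induced subgraphs meeting in C, and both sides of the
   inequality are additive up to the same constant: C has 8 cliques, 3 vertices
   and 3 edges, and 8 = 3 + (7/3) 3 - 2. Otherwise every edge uv lies in at most
   two triangles; then a k-clique with k >= 2 extends to at most 4 - k cliques of
   size k + 1, and double counting bounds the numbers of larger cliques by m.

   The bound of two triangles per edge is the only consequence of planarity
   needed. Suppose u and v have common neighbours w1, w2, w3, and the complement
   of each triangle C_i = u v w_i is connected. Let n(xy; p) be the parity of the
   number of intersections of the arc xy with the leftward ray from p, and let
   h(x, y) say that x lies below y. Two disjoint arcs xy and zw satisfy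
     n(xy;z) + n(xy;w) + n(zw;x) + n(zw;y) = h(x,z) + h(y,z) + h(x,w) + h(y,w),
   since the difference of the arcs maps the unit square to the punctured plane.
   Hence w_j and w_k have equal winding parity with respect to C_i, for every i.
   Summing the identity over the six pairs (u w_i, v w_j) leaves
   0 = sum_(i < j) (h(w_i,w_j) + h(w_j,w_i)) = 3 mod 2. *)

(* [n] stands for the parities n(xy; p) and [h] for the order h(x, y) above. *)
Definition crossing_parity (T : finType) (e h : rel T) (n : T -> T -> T -> bool) :=
  (forall x y, x != y -> h x y = ~~ h y x) /\
  (forall x y z w, e x y -> e z w -> x != z -> x != w -> y != z -> y != w ->
     n x y z (+) n x y w (+) n z w x (+) n z w y =
     h x z (+) h y z (+) h x w (+) h y w).

(** * Parity of ray crossings in a plane drawing *)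

Section PlaneDrawings.
Import all_classical all_reals all_analysis Rstruct Rstruct_topology.
Import numFieldNormedType.Exports.
Local Open Scope ring_scope.
Local Open Scope classical_set_scope.

(** The open lower half-plane together with the negative axis, so that exactly one of [a] and [- a]
    is lower for every nonzero [a]. Points of equal height are thereby ordered from left to
    right. *)
Definition lower (R : realFieldType) (a : R * R) : bool :=
  (a.2 < 0) || ((a.2 == 0) && (a.1 < 0)).

(* Whether a short segment from [a] to [b] meets the negative real axis; only
   meaningful when [b] is closer to [a] than the origin is. *)
Definition crossing (R : realFieldType) (a b : R * R) : bool :=
  (lower a (+) lower b) && (a.1 < 0).

Lemma lowerN (R : realFieldType) (a : R * R) : a != 0 -> lower (- a) = ~~ lower a.
Proof.
case: a => x y; rewrite /lower -pair_eqE /= !oppr_lt0 oppr_eq0.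
by case: (ltgtP y 0) => //= _; rewrite andbT; case: ltgtP.
Qed.

(** In the maximum norm the ball is an open square around [o] with the origin on its boundary; it
    stays on one side of a coordinate axis, chosen by the larger coordinate of [o]. *)
Lemma near_nonzero_cases (R : realFieldType) (o : R * R) :
  [\/ forall a, `|a - o| < `|o| -> a.1 < 0,
      forall a, `|a - o| < `|o| -> 0 < a.1 |
      forall a, `|a - o| < `|o| -> lower a = lower o].
Proof.
have comp (a : R * R) r : `|a - o| < r -> `|a.1 - o.1| < r /\ `|a.2 - o.2| < r.
  by rewrite prod_normE gt_max => /andP.
rewrite [`|o|]prod_normE; have [le21|lt12] := leP `|o.1| `|o.2|; last first.
  have [s0|s0] := leP 0 o.1.
    constructor 2 => a /comp[+ _]; rewrite (ger0_norm s0) ltr_norml; lra.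
  constructor 1 => a /comp[+ _]; rewrite (ltr0_norm s0) ltr_norml; lra.
constructor 3 => a /comp[_]; rewrite /lower.
have [s0|s0|->] := ltgtP o.2 0; last by rewrite normr0 normr_lt0.
  rewrite (ltr0_norm s0) ltr_norml => aP.
  have -> // : a.2 < 0 by lra.
rewrite (gtr0_norm s0) ltr_norml => aP.
have a0 : 0 < a.2 by lra.
by rewrite (lt_gtF a0) (gt_eqF a0).
Qed.

(** On the ball of radius [|o|] around [o], [crossing a b] is either always zero or always
    [lower a (+) lower b], so its sum around a quadrilateral vanishes. *)
Lemma crossing_cell (R : realFieldType) (o a b c : R * R) :
  `|a - o| < `|o| -> `|b - o| < `|o| -> `|c - o| < `|o| ->
  crossing o a (+) crossing a b (+) crossing c b (+) crossing o c = false.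
Proof.
move=> ao bo co.
have oo : `|o - o| < `|o|.
  by rewrite subrr normr0; apply: le_lt_trans ao; rewrite normr_ge0.
rewrite /crossing; case: (near_nonzero_cases o) => H.
- by rewrite !H//; do 4 case: lower.
- by rewrite !(lt_gtF (H _ _))// !andbF.
- by rewrite (H a) ?(H b) ?(H c)// addbb.
Qed.

(** Negation makes [crossing] test the positive axis instead. A short segment can meet the real axis
    on one side of the origin only, and [lower a (+) lower b] detects both kinds of crossing. *)
Lemma crossingN (R : realFieldType) (a b : R * R) : `|b - a| < `|a| ->
  crossing (- a) (- b) = crossing a b (+) lower a (+) lower b.
Proof.
move=> ab.
have a0 : a != 0 by rewrite -normr_gt0; apply: le_lt_trans ab.
have b0 : b != 0.
  by apply: contraTneq ab => ->; rewrite sub0r normrN ltxx.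
have aa : `|a - a| < `|a| by rewrite subrr normr0 normr_gt0.
rewrite /crossing !lowerN //=; case: (near_nonzero_cases a) => H.
- by rewrite oppr_lt0 (lt_gtF (H a aa)) (H a aa); do 2 case: lower.
- by rewrite oppr_lt0 (lt_gtF (H a aa)) (H a aa); do 2 case: lower.
- by rewrite (H b)//; case: lower.
Qed.

Lemma addb_telescope (f : nat -> bool) n :
  \big[addb/false]_(i < n) (f i (+) f i.+1) = f 0%N (+) f n.
Proof.
elim: n => [|n IH]; first by rewrite big_ord0 addbb.
by rewrite big_ord_recr IH /=; case: (f 0%N); case: (f n); case: (f n.+1).
Qed.

(** A discrete Stokes formula mod 2: in the sum over all cells every inner edge occurs twice. [H]
    and [V] label the edges in the two grid directions. *)
Lemma grid_boundary (H V : nat -> nat -> bool) m n :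
  (forall k l, (k < m)%N -> (l < n)%N ->
     H k l (+) V k.+1 l (+) H k l.+1 (+) V k l = false) ->
  \big[addb/false]_(k < m) H k 0%N (+) \big[addb/false]_(k < m) H k n
    = \big[addb/false]_(l < n) V 0%N l (+) \big[addb/false]_(l < n) V m l.
Proof.
move=> cell; have row k : (k < m)%N -> H k 0%N (+) H k n =
    \big[addb/false]_(l < n) V k l (+) \big[addb/false]_(l < n) V k.+1 l.
  move=> km; rewrite -(addb_telescope (H k)) -big_split.
  apply: eq_bigr => l _ /=; have := cell k l km (ltn_ord l).
  by case: (H k l); case: (V k.+1 l); case: (H k l.+1); case: (V k l).
rewrite -(addb_telescope (fun k => \big[addb/false]_(l < n) V k l)).
by rewrite -big_split; apply: eq_bigr => k _; rewrite /= row.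
Qed.

(** The parity of intersections with the leftward ray from [p], read off from samples of a curve;
    meaningful when each step is shorter than the distance to [p]. *)
Definition ray_crossings (R : realFieldType) (f : nat -> R * R) (N : nat)
  (p : R * R) : bool :=
  \big[addb/false]_(k < N) crossing (f k - p) (f k.+1 - p).

(** The differences [f k - g l] form a grid whose cells avoid the origin. Two opposite sides count
    crossings of [f]; the other two count those of [g] after a change of sign, whose corrections
    telescope to the [lower] terms. *)
Lemma ray_crossings_swap (R : realFieldType) (f g : nat -> R * R) (N : nat) :
  (forall k l k' l', (k <= N)%N -> (l <= N)%N -> (k' <= N)%N -> (l' <= N)%N ->
     (k <= k' <= k.+1)%N -> (l <= l' <= l.+1)%N ->
     `|(f k' - g l') - (f k - g l)| < `|f k - g l|) ->
  ray_crossings f N (g 0%N) (+) ray_crossings f N (g N) (+)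
  ray_crossings g N (f 0%N) (+) ray_crossings g N (f N) =
  lower (f 0%N - g 0%N) (+) lower (f N - g 0%N) (+)
  lower (f 0%N - g N) (+) lower (f N - g N).
Proof.
move=> close.
pose F k l := f k - g l.
have bd := @grid_boundary (fun k l => crossing (F k l) (F k.+1 l))
  (fun k l => crossing (F k l) (F k l.+1)) N N.
have {}bd := bd _; rewrite {1}/ray_crossings {1}/ray_crossings bd.
  have side k : (k <= N)%N -> ray_crossings g N (f k) =
      \big[addb/false]_(l < N) crossing (F k l) (F k l.+1)
      (+) lower (F k 0%N) (+) lower (F k N).
    move=> kN; rewrite -addbA -(addb_telescope (fun l => lower (F k l))).
    rewrite -big_split; apply: eq_bigr => l _.
    rewrite -(opprB (f k)) -(opprB (f k) (g l.+1)) crossingN.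
      by rewrite -addbA.
    by apply: close; rewrite ?leqnn ?leqnSn // ltnW.
  rewrite !side ?leqnn// /F.
  case: (lower _); case: (lower _); case: (lower _); case: (lower _);
  by case: (\big[_/_]_(i < N) _); case: (\big[_/_]_(i < N) _).
move=> k l kN lN; apply: crossing_cell; apply: close;
  by rewrite ?leqnn ?leqnSn // ltnW.
Qed.

(** On the compact square the distance between the arcs is positive, and a covering argument makes
    the choice of mesh uniform. *)
Lemma disjoint_arcs_mesh (K : realType) (f g : K -> K * K) :
  {within `[0, 1], continuous f} -> {within `[0, 1], continuous g} ->
  (forall s t, `[0, 1] s -> `[0, 1] t -> f s <> g t) ->
  \forall N \near \oo, forall s t s' t',
    `[0, 1] s -> `[0, 1] t -> `[0, 1] s' -> `[0, 1] t' ->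
    `|s' - s| <= N.+1%:R^-1 -> `|t' - t| <= N.+1%:R^-1 ->
    `|(f s' - g t') - (f s - g t)| < `|f s - g t|.
Proof.
move=> /subspace_continuousP cf /subspace_continuousP cg fg.
have cpt : compact ((`[0, 1] : set K) `*` (`[0, 1] : set K)).
  by apply: compact_setX; exact: segment_compact.
have FF : Filter \oo by exact: eventually_filter.
have := (compact_near_coveringP _).1 cpt nat \oo (fun N p =>
  `[0, 1] p.1 -> `[0, 1] p.2 -> forall s' t',
  `[0, 1] s' -> `[0, 1] t' ->
    `|s' - p.1| <= N.+1%:R^-1 -> `|t' - p.2| <= N.+1%:R^-1 ->
    `|(f s' - g t') - (f p.1 - g p.2)| < `|f p.1 - g p.2|) FF => covering.
apply: filterS (covering _) => [N HN s t s' t' us ut us' ut' | ]; last first.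
  move=> [s0 t0] [/= us0 ut0].
  pose r := `|f s0 - g t0|.
  have r0 : 0 < r.
    by rewrite normr_gt0 subr_eq0; apply/eqP; exact: fg.
  (* Two values within [r / 8] of the central one differ by less than [r / 4]. Thus [f s - g t]
     moves by less than [r / 2], while its norm stays above [3 r / 4]. *)
  have r8 : 0 < r / 8 by lra.
  have cf0 : f @ within `[0, 1] (nbhs s0) --> f s0 := cf s0 us0.
  have /nbhs_ballP[d1 /= d10 Hf] :
      nbhs s0 (fun x => `[0, 1]%classic x -> `|f s0 - f x| < r / 8).
    exact: (cvgrPdist_lt f (f s0)).1 cf0 _ r8.
  have cg0 : g @ within `[0, 1] (nbhs t0) --> g t0 := cg t0 ut0.
  have /nbhs_ballP[d2 /= d20 Hg] :
      nbhs t0 (fun x => `[0, 1]%classic x -> `|g t0 - g x| < r / 8).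
    exact: (cvgrPdist_lt g (g t0)).1 cg0 _ r8.
  pose d := Num.min d1 d2.
  have d0 : 0 < d by rewrite lt_min d10.
  have [dd1 dd2] : d <= d1 /\ d <= d2 by rewrite /d !ge_min !lexx orbT.
  (* One half is for the distance to the centre, the other for the mesh step. *)
  have d2p : 0 < d / 2 by lra.
  exists (ball s0 (d / 2) `*` ball t0 (d / 2), [set N : nat | N.+1%:R^-1 < d / 2]).
    split; last exact: (near_infty_natSinv_lt (PosNum d2p)).
    exists (ball s0 (d / 2), ball t0 (d / 2)) => //.
    by split; apply: nbhsx_ballx.
  move=> [[s t] N] [[/= bs bt] dN0] us ut s' t' us' ut' ss' tt'.
  have dN : N.+1%:R^-1 < d / 2 := dN0.
  move: (N.+1%:R^-1) dN ss' tt' => q dN ss' tt'.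
  move: bs bt; rewrite -!ball_normE /ball_ /= => bs bt.
  have Fs := Hf s; have Fs' := Hf s'; have Gt := Hg t; have Gt' := Hg t'.
  rewrite -!ball_normE /ball_ /= in Fs Fs' Gt Gt'.
  have {}Fs : `|f s0 - f s| < r / 8 by apply: Fs => //; lra.
  have {}Gt : `|g t0 - g t| < r / 8 by apply: Gt => //; lra.
  have {}Fs' : `|f s0 - f s'| < r / 8.
    apply: Fs' => //; have := ler_distD s s0 s'; rewrite (distrC s s'); lra.
  have {}Gt' : `|g t0 - g t'| < r / 8.
    apply: Gt' => //; have := ler_distD t t0 t'; rewrite (distrC t t'); lra.
  have h1 := ler_distD (f s0) (f s') (f s); rewrite (distrC (f s') (f s0)) in h1.
  have h2 := ler_distD (g t0) (g t') (g t); rewrite (distrC (g t') (g t0)) in h2.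
  have h3 : `|f s' - g t' - (f s - g t)| <= `|f s' - f s| + `|g t' - g t|.
    by rewrite opprD addrACA -opprD; exact: ler_normB.
  have h4 : r <= `|f s0 - f s| + `|f s - g t| + `|g t0 - g t|.
    rewrite (distrC (g t0)); apply: le_trans (ler_distD (g t) _ _) _.
    by rewrite lerD2r; exact: ler_distD.
  lra.
exact: (HN (s, t)).
Qed.

Lemma planar_crossing_parity (T : finType) (e : rel T) : planar e ->
  exists (h : rel T) (n : T -> T -> T -> bool), crossing_parity e h n.
Proof.
move=> [pos [arc [pos_inj drawing]]].
pose indep (p : T * T * (T * T)) :=
  [&& e p.1.1 p.1.2, e p.2.1 p.2.2, p.1.1 != p.2.1, p.1.1 != p.2.2,
      p.1.2 != p.2.1 & p.1.2 != p.2.2].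
(* There are finitely many pairs of independent edges, so one mesh serves them all. *)
have : \forall N \near \oo, forall p : T * T * (T * T), indep p ->
   forall s t s' t',
    unit_interval s -> unit_interval t -> unit_interval s' -> unit_interval t' ->
    `|s' - s| <= N.+1%:R^-1 -> `|t' - t| <= N.+1%:R^-1 ->
    `|(arc p.1.1 p.1.2 s' - arc p.2.1 p.2.2 t')
       - (arc p.1.1 p.1.2 s - arc p.2.1 p.2.2 t)|
     < `|arc p.1.1 p.1.2 s - arc p.2.1 p.2.2 t|.
  apply: filter_forall => -[[x y] [z w]].
  case: (boolP (indep (x, y, (z, w)))) => [|ni]; last first.
    by apply: nearW.
  rewrite /indep /= => /and5P[exy ezw xz xw /andP[yz yw]].
  have [cf [f0 f1] _ fpos fdisj] := drawing x y exy.
  have [cg [g0 g1] _ gpos _] := drawing z w ezw.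
  have unit_cases t : unit_interval t -> [\/ t = 0, t = 1 | open_unit_interval t].
    rewrite /unit_interval /open_unit_interval /= => /andP[].
    rewrite le_eqVlt => /predU1P[<-|t0]; first by constructor 1.
    rewrite le_eqVlt => /predU1P[->|t1]; first by constructor 2.
    by constructor 3; rewrite t0.
  have posD a b : a != b -> pos a <> pos b by move=> /eqP ab /pos_inj.
  have itvE : unit_interval = `[0, 1]%classic.
    by apply/seteqP; split=> t; rewrite /unit_interval /= in_itv.
  rewrite itvE in cf cg unit_cases *.
  apply: filterS (disjoint_arcs_mesh cf cg _) => [N HN _|] //.
  move=> s t /unit_cases[->|->|s01] /unit_cases[->|->|t01];
    rewrite ?f0 ?f1 ?g0 ?g1; try by apply: posD.
  - by apply/nesym/gpos.
  - by apply/nesym/gpos.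
  - exact: fpos.
  - exact: fpos.
  - apply: fdisj => //; apply/eqP => /setP/(_ x).
    by rewrite !inE eqxx (negbTE xz) (negbTE xw).
move=> /filter_ex[N mesh].
(* The indices [0] to [N.+1] give [N.+1] steps, and both end points of the arc are samples. *)
pose sample x y k : plane := arc x y (k%:R / N.+1%:R).
exists (fun x y => lower (pos x - pos y)).
exists (fun x y p => ray_crossings (sample x y) N.+1 (pos p)).
split=> [x y xy|x y z w exy ezw xz xw yz yw].
  by rewrite -(opprB (pos y)) lowerN// subr_eq0; apply: contra_neq xy => /pos_inj.
have N0 : N.+1%:R != 0 :> Rdefinitions.R by rewrite pnatr_eq0.
have ends a b : e a b -> sample a b 0%N = pos a /\ sample a b N.+1 = pos b.
  by move=> /drawing[_ [a0 b1] _ _ _]; rewrite /sample mul0r divff.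
have [<- <-] := ends _ _ exy; have [<- <-] := ends _ _ ezw.
apply: ray_crossings_swap => k l k' l' kN lN k'N l'N kk' ll'.
have unitP j : (j <= N.+1)%N -> unit_interval (j%:R / N.+1%:R : Rdefinitions.R).
  move=> jN; rewrite /unit_interval /= divr_ge0//=.
  by rewrite ler_pdivrMr ?ltr0n// mul1r ler_nat.
have stepP i j : (i <= j <= i.+1)%N ->
    `|j%:R / N.+1%:R - i%:R / N.+1%:R| <= N.+1%:R^-1 :> Rdefinitions.R.
  move=> /andP[ij ji]; rewrite -mulrBl -natrB// normrM normfV !normr_nat.
  by rewrite ler_piMl ?invr_ge0// lern1 leq_subLR addn1.
apply: (mesh (x, y, (z, w))); rewrite ?/indep /=; try exact: unitP; try exact: stepP.
by rewrite exy ezw xz xw yz.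
Qed.

End PlaneDrawings.

(** * Counting cliques along separating triangles *)

Section CliqueCounting.
Variables (T : finType) (e : rel T).
Hypotheses (e_sym : symmetric e) (e_irr : irreflexive e).

(** Induced subgraphs are represented by their vertex sets, so that the induction stays inside the
    fixed type [T]. *)
Definition cliques_in (S : {set T}) : {set {set T}} :=
  [set A : {set T} | is_clique e A & A \subset S].

Definition kcliques_in (k : nat) (S : {set T}) : {set {set T}} :=
  [set A in cliques_in S | #|A| == k].

Lemma is_cliqueP (A : {set T}) :
  reflect {in A &, forall x y, x != y -> e x y} (is_clique e A).
Proof.
apply: (iffP forall_inP) => [H x y xA yA xy|H x xA].
  by have /forall_inP/(_ y yA)/implyP/(_ xy) := H x xA.
by apply/forall_inP=> y yA; apply/implyP; exact: H.
Qed.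

Lemma is_cliqueS (A B : {set T}) : A \subset B -> is_clique e B -> is_clique e A.
Proof.
move=> /subsetP AB /is_cliqueP H; apply/is_cliqueP=> x y xA yA.
by apply: H; exact: AB.
Qed.

Lemma is_clique_setU1 (x : T) (A : {set T}) :
  is_clique e A -> {in A, forall y, e x y} -> is_clique e (x |: A).
Proof.
move=> /is_cliqueP cA xA; apply/is_cliqueP=> y z.
rewrite !inE => /predU1P[->|yA] /predU1P[->|zA]; first by rewrite eqxx.
- by move=> _; exact: xA.
- by move=> _; rewrite e_sym; exact: xA.
- exact: cA.
Qed.

Lemma edgesE : edges e = kcliques_in 2 setT.
Proof.
apply/setP=> A; rewrite !inE subsetT andbT; apply/existsP/andP.
  move=> [x /existsP[y /andP[exy /eqP->]]].
  have xy : x != y by apply: contraTneq exy => ->; rewrite e_irr.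
  rewrite cards2 xy; split=> //; apply: is_clique_setU1.
    by apply/is_cliqueP=> a b; rewrite !inE => /eqP-> /eqP->; rewrite eqxx.
  by move=> z; rewrite inE => /eqP->.
move=> [/is_cliqueP cA /cards2P[x][y][xy Axy]]; exists x; apply/existsP; exists y.
by rewrite {1}Axy eqxx andbT; apply: cA; rewrite // Axy !inE eqxx ?orbT.
Qed.

Lemma num_cliquesE : num_cliques e = #|cliques_in setT|.
Proof. by apply: eq_card => A; rewrite !inE subsetT andbT. Qed.

(* Removing one vertex at a time gives every (k+1)-clique k+1 facets. *)
Lemma kcliques_in_double_count (S : {set T}) (k r : nat) :
  (forall A, A \in kcliques_in k S ->
     #|[set x in S | is_clique e (x |: A) & x \notin A]| <= r) ->
  k.+1 * #|kcliques_in k.+1 S| <= r * #|kcliques_in k S|.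
Proof.
move=> ext_le.
have -> : k.+1 * #|kcliques_in k.+1 S| =
    \sum_(B in kcliques_in k.+1 S) \sum_(x in B) 1.
  rewrite mulnC -sum_nat_const; apply: eq_bigr => B.
  by rewrite inE sum1_card => /andP[_ /eqP].
have -> : r * #|kcliques_in k S| = \sum_(A in kcliques_in k S) r.
  by rewrite sum_nat_const mulnC.
apply: (@leq_trans (\sum_(A in kcliques_in k S)
   \sum_(x in [set x in S | is_clique e (x |: A) & x \notin A]) 1)); last first.
  by apply: leq_sum => A /ext_le; rewrite sum1_card.
rewrite !pair_big_dep /= !sum1dep_card.
(* Keeping the removed vertex as second component makes the map injective. *)
pose f (p : {set T} * T) := (p.1 :\ p.2, p.2).
rewrite -(@card_in_imset _ _ f); last first.
  move=> [B x] [B' x']; rewrite !inE /= => /andP[_ xB] /andP[_ xB'] [eqB eqx].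
  by move: xB' eqB; rewrite -eqx => xB' eqB; rewrite -(setD1K xB) -(setD1K xB') eqB.
apply/subset_leq_card/subsetP=> _ /imsetP[[B x] + ->].
rewrite !inE /= => /andP[/andP[/andP[cB BS] /eqP Bk] xB].
rewrite setD1K// cB eqxx (subsetP BS)//= (is_cliqueS (subsetDl _ _) cB).
rewrite (subset_trans (subsetDl _ _) BS) /= andbT.
by have := cardsD1 x B; rewrite xB Bk => -[->].
Qed.

(** A clique meeting [A] cannot meet [B]. A clique on both sides lies in [C], all of whose subsets
    are cliques. *)
Lemma cliques_in_glue (C A B : {set T}) :
  is_clique e C -> [disjoint A & B] ->
  {in A & B, forall x y, ~~ e x y} ->
  cliques_in (A :|: B :|: C) = cliques_in (A :|: C) :|: cliques_in (B :|: C) /\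
  cliques_in (A :|: C) :&: cliques_in (B :|: C) = powerset C.
Proof.
move=> cC AB noedge; split; apply/setP=> X; rewrite !inE.
  rewrite -andb_orr; case: (boolP (is_clique e X)) => //= /is_cliqueP cX.
  apply/idP/orP; last first.
    by case=> XS; apply: (subset_trans XS); apply/subsetP=> x; rewrite !inE;
      case: (x \in A); case: (x \in B).
  move=> /subsetP XS.
  have [/existsP[x /andP[xX xA]]|] := boolP [exists x, (x \in X) && (x \in A)].
    left; apply/subsetP=> y yX; have := XS y yX; rewrite !inE.
    case: (boolP (y \in B)) => yB; last by rewrite orbF.
    have : x != y.
      by apply: contraTneq yB => <-; rewrite (disjointFr AB xA).
    by move=> /(cX x y xX yX) exy; have := noedge x y xA yB; rewrite exy.
  move=> /existsPn noA; right; apply/subsetP=> y yX.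
  by have := XS y yX; have := noA y; rewrite !inE yX /= => /negbTE->.
have -> : (X \subset C) = (X \subset A :|: C) && (X \subset B :|: C).
  by rewrite -subsetI -setUIl (disjoint_setI0 AB) set0U.
case: (boolP (is_clique e X)) => //= nX; symmetry; apply/negbTE.
apply: contra nX; rewrite -subsetI -setUIl (disjoint_setI0 AB) set0U => XC.
exact: is_cliqueS XC cC.
Qed.

Lemma card_cliques_in_glue (C A B : {set T}) :
  is_clique e C -> [disjoint A & B] ->
  {in A & B, forall x y, ~~ e x y} -> #|C| = 3 ->
  [/\ #|A :|: B :|: C| + 3 = #|A :|: C| + #|B :|: C|,
      #|cliques_in (A :|: B :|: C)| + 8
        = #|cliques_in (A :|: C)| + #|cliques_in (B :|: C)| &
      #|kcliques_in 2 (A :|: B :|: C)| + 3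
        = #|kcliques_in 2 (A :|: C)| + #|kcliques_in 2 (B :|: C)|].
Proof.
move=> cC AB noedge C3.
have [cliqU cliqI] := cliques_in_glue cC AB noedge.
split.
- by rewrite -cardsUI -setUUl -setUIl (disjoint_setI0 AB) set0U C3.
- by rewrite -cardsUI -cliqU cliqI card_powerset C3.
- have kE S : kcliques_in 2 S = cliques_in S :&: [set X : {set T} | #|X| == 2].
    by apply/setP=> X; rewrite !inE.
  rewrite -cardsUI !kE -setIUl -cliqU setIACA setIid cliqI; congr (_ + _).
  have -> : powerset C :&: [set X : {set T} | #|X| == 2] =
    [set X : {set T} | X \subset C & #|X| == 2] by apply/setP=> X; rewrite !inE.
  by rewrite cards_draws C3.
Qed.

(** With [m] edges, [t] triangles and [k] cliques of size 4, double counting gives [3 t <= 2 m] and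
    [4 k <= t]. In integers this suffices for [m >= 4]; the case [m = 3] needs [t <= 1]. *)
Lemma card_cliques_in_of_le2 (S : {set T}) :
  (forall u v, u \in S -> v \in S -> e u v ->
     #|[set w in S | e u w & e v w]| <= 2) ->
  3 <= #|kcliques_in 2 S| ->
  3 * #|cliques_in S| + 6 <= 3 * #|S| + 7 * #|kcliques_in 2 S|.
Proof.
move=> common_le2 m3.
have step k : 2 <= k ->
    k.+1 * #|kcliques_in k.+1 S| <= (4 - k) * #|kcliques_in k S|.
  move=> k2; apply: kcliques_in_double_count => A.
  rewrite !inE => /andP[/andP[/is_cliqueP cA /subsetP AS] /eqP Ak].
  have /card_gt1P[u [v [uA vA uv]]] : 1 < #|A| by rewrite Ak.
  have euv := cA u v uA vA uv.
  have := common_le2 u v (AS u uA) (AS v vA) euv.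
  set W := [set w in S | _]; set X := [set x in S | _] => W2.
  (* The vertices extending [A] and the [k - 2] other vertices of [A] are disjoint sets of common
     neighbours of [u] and [v], which leaves at most [2 - (k - 2)] extensions. *)
  have XAW : X :|: (A :\: [set u; v]) \subset W.
    apply/subsetP=> x; rewrite !inE negb_or -andbA.
    case/orP=> [/and3P[xS /is_cliqueP cxA xA]|/and3P[xu xv xA]].
      rewrite xS /= !(e_sym _ x) !cxA ?inE ?eqxx ?uA ?vA ?orbT//.
        by apply: contraNneq xA => ->.
      by apply: contraNneq xA => ->.
    by rewrite AS//= !cA// eq_sym.
  have disj : X :&: (A :\: [set u; v]) = set0.
    by apply/setP=> x; rewrite !inE; case: (x \in A); rewrite ?andbF.
  have := leq_trans (subset_leq_card XAW) W2.
  have := cardsUI X (A :\: [set u; v]); rewrite disj cards0.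
  have : #|A :\: [set u; v]| = k - 2.
    rewrite cardsD Ak; congr (_ - _).
    have /setIidPr-> : [set u; v] \subset A by rewrite subUset !sub1set uA.
    by rewrite cards2 uv.
  lia.
(* From [k = 4] on, the truncated difference [4 - k] is 0 and no extension exists. *)
have k5 k : 5 <= k -> #|kcliques_in k S| = 0.
  case: k => // k k4; have k2 : 1 < k by lia.
  by have := step k k2; rewrite (_ : 4 - k = 0) ?mul0n ?leqn0 ?muln_eq0 => [/eqP|]; lia.
have card_split : #|cliques_in S| = \sum_(k < #|T|.+1) #|kcliques_in k S|.
  rewrite -sum1_card.
  rewrite (partition_big (fun A : {set T} => inord #|A| : 'I_#|T|.+1) xpredT)//=.
  apply: eq_bigr => k _; rewrite sum1dep_card; apply: eq_card => A.
  rewrite !inE; congr (_ && _).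
  by rewrite -val_eqE /= inordK// ltnS max_card.
have k0 : #|kcliques_in 0 S| = 1.
  rewrite -(cards1 (set0 : {set T})); apply: eq_card => A; rewrite !inE cards_eq0.
  case: eqP => [->|_]; rewrite ?andbF//= sub0set !andbT.
  by apply/is_cliqueP=> x y; rewrite inE.
have k1 : #|kcliques_in 1 S| = #|S|.
  rewrite -(card_imset (mem S) set1_inj); apply: eq_card => A; rewrite !inE.
  apply/andP/imsetP=> [[/andP[_ AS] /cards1P[x Ax]]|[x xS ->]].
    by exists x; rewrite // -sub1set -Ax.
  rewrite cards1 sub1set xS andbT; split=> //.
  by apply/is_cliqueP=> a b; rewrite !inE => /eqP-> /eqP->; rewrite eqxx.
have total : #|cliques_in S| <= 1 + #|S| + #|kcliques_in 2 S|
    + #|kcliques_in 3 S| + #|kcliques_in 4 S|.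
  have -> : 1 + #|S| + #|kcliques_in 2 S| + #|kcliques_in 3 S| + #|kcliques_in 4 S|
    = \sum_(k < 5) #|kcliques_in k S| by rewrite !big_ord_recr big_ord0 /= k0 k1.
  rewrite card_split -!(big_mkord xpredT (fun k => #|kcliques_in k S|)).
  have [le5|lt5] := leqP 5 #|T|.+1.
    rewrite (big_cat_nat (n := 5))//= [X in _ + X]big_nat_cond [X in _ + X]big1 ?addn0//.
    by move=> k /andP[/andP[/k5]].
  by rewrite (big_cat_nat (n := #|T|.+1) (p := 5)) ?leq_addr// ltnW.
(* Double counting alone would allow two triangles. But the pairs in one triangle already exhaust
   the three edges, so any other triangle has the same vertices. *)
have small : #|kcliques_in 2 S| = 3 -> #|kcliques_in 3 S| <= 1.
  move=> m_eq3; rewrite leqNgt; apply/negP=> /card_gt1P[A [B [+ + AB]]].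
  rewrite !inE => /andP[/andP[cA AS] /eqP A3] /andP[/andP[cB BS] /eqP B3].
  have kA : [set X : {set T} | X \subset A & #|X| == 2] = kcliques_in 2 S.
    apply/eqP; rewrite eqEcard m_eq3 cards_draws A3 andbT; apply/subsetP=> X.
    rewrite !inE => /andP[XA ->].
    by rewrite (is_cliqueS XA cA) (subset_trans XA AS).
  case/negP: AB; rewrite eq_sym eqEcard A3 B3 andbT; apply/subsetP=> x xB.
  have /card_gt1P[y [z [yB zB yz]]] : 1 < #|B| by rewrite B3.
  have [w wB xw] : exists2 w, w \in B & x != w.
    have [xy|xy] := eqVneq x y; first by exists z; rewrite ?xy.
    by exists y.
  have xwB : [set x; w] \subset B by rewrite subUset !sub1set xB.
  have : [set x; w] \in kcliques_in 2 S.
    rewrite !inE cards2 xw (is_cliqueS xwB cB).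
    by rewrite (subset_trans xwB BS).
  by rewrite -kA inE => /andP[/subsetP/(_ x) + _]; apply; rewrite !inE eqxx.
move: (step 2 isT) (step 3 isT) total m3 small.
move: #|cliques_in S| #|S| #|kcliques_in 2 S| #|kcliques_in 3 S| #|kcliques_in 4 S|.
move=> {step k5 card_split k0 k1 common_le2} c s m t k; rewrite /subn /=.
case: (eqVneq m 3) => [->|m3] m_t t_k c_le m_ge; first by move=> /(_ erefl); lia.
by move=> _; lia.
Qed.

(** * Splitting along separating triangles *)

Definition induced_rel (S : {set T}) : rel T :=
  fun x y => [&& x \in S, y \in S & e x y].

Definition nonseparating_triangle (S C : {set T}) : bool :=
  [forall p in S :\: C, forall q in S :\: C, connect (induced_rel (S :\: C)) p q].

(** Planarity enters only through the first hypothesis, which ranges over all [S'] because the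
    induction passes to smaller vertex sets. *)
Lemma card_cliques_in_le (S : {set T}) :
  (forall S' : {set T},
     (forall C, C \in kcliques_in 3 S' -> nonseparating_triangle S' C) ->
     forall u v, u \in S' -> v \in S' -> e u v ->
     #|[set w in S' | e u w & e v w]| <= 2) ->
  3 <= #|kcliques_in 2 S| ->
  3 * #|cliques_in S| + 6 <= 3 * #|S| + 7 * #|kcliques_in 2 S|.
Proof.
move=> nonseparating_le2; have [N] := ubnP #|S|; elim: N S => // N IH S; rewrite ltnS => SN m3.
have [/forall_inP nosep|] :=
    boolP [forall C in kcliques_in 3 S, nonseparating_triangle S C].
  by apply: card_cliques_in_of_le2 => //; exact: nonseparating_le2.
rewrite negb_forall_in => /exists_inP[C].
rewrite !inE => /andP[/andP[cC CS] /eqP C3].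
rewrite negb_forall_in => /exists_inP[p pS].
rewrite negb_forall_in => /exists_inP[q qS npq].
(* The component of [p] outside [C]; it misses [q]. *)
pose A := [set x in S :\: C | connect (induced_rel (S :\: C)) p x].
pose B := (S :\: C) :\: A.
have AS : A \subset S :\: C by apply/subsetP=> x; rewrite inE => /andP[].
have pA : p \in A by rewrite inE pS connect0.
have qB : q \in B by rewrite inE qS andbT inE qS.
have AB : [disjoint A & B].
  by rewrite disjoint_sym disjoints_subset; apply/subsetP=> x; rewrite !inE => /andP[].
have noedge : {in A & B, forall x y, ~~ e x y}.
  move=> x y; rewrite inE => /andP[xS px]; rewrite inE => /andP[+ yS].
  rewrite inE yS /=; apply: contra => exy.
  by apply: connect_trans px (connect1 _); rewrite /induced_rel xS yS.
have SE : S = A :|: B :|: C.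
  have -> : A :|: B = S :\: C.
    by rewrite -[RHS](setID _ A); congr (_ :|: _); apply/esym/setIidPr.
  by rewrite -{1}(setID S C) (setIidPr CS) setUC.
have [card_S card_c card_m] := card_cliques_in_glue cC AB noedge C3.
(* Both sides contain the three edges of [C], so the lower bound on edges survives the induction. *)
have m_ge3 (D : {set T}) : 3 <= #|kcliques_in 2 (D :|: C)|.
  have -> : 3 = #|[set X : {set T} | X \subset C & #|X| == 2]|.
    by rewrite cards_draws C3.
  apply/subset_leq_card/subsetP=> X; rewrite !inE => /andP[XC ->].
  by rewrite (is_cliqueS XC cC) (subset_trans XC (subsetUr _ _)).
(* Since the sizes of the two sides add up to [#|S| + 3], a side with more than three vertices makes
   the other one smaller than [S]. *)
have card_gt3 (D : {set T}) x : x \in S :\: C -> x \in D -> 3 < #|D :|: C|.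
  rewrite inE => /andP[xC _] xD; rewrite -C3; apply: proper_card.
  rewrite properE subsetUr /=; apply/subsetPn; exists x => //.
  by rewrite inE xD.
have A_gt3 := card_gt3 A p pS pA; have B_gt3 := card_gt3 B q qS qB.
rewrite -SE in card_S card_c card_m.
have IHA := IH (A :|: C) _ (m_ge3 A); have IHB := IH (B :|: C) _ (m_ge3 B).
have {}IHA : 3 * #|cliques_in (A :|: C)| + 6 <=
    3 * #|A :|: C| + 7 * #|kcliques_in 2 (A :|: C)| by apply: IHA; lia.
have {}IHB : 3 * #|cliques_in (B :|: C)| + 6 <=
    3 * #|B :|: C| + 7 * #|kcliques_in 2 (B :|: C)| by apply: IHB; lia.
move: IHA IHB card_S card_c card_m {SN A_gt3 B_gt3 m3}.
move: #|S| #|A :|: C| #|B :|: C| #|cliques_in S| #|cliques_in (A :|: C)|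
  #|cliques_in (B :|: C)| #|kcliques_in 2 S| #|kcliques_in 2 (A :|: C)|
  #|kcliques_in 2 (B :|: C)|.
lia.
Qed.
End CliqueCounting.

(** * Triangles on a common edge *)

Lemma addb_eq0 (a b : bool) : a = b <-> a (+) b = false.
Proof. by case: a; case: b. Qed.

Lemma addbE (a b : bool) : a (+) b = xorb a b.
Proof. by case: a. Qed.

Ltac addb_ring := rewrite !addbE; btauto.

Section CrossingParity.
Variables (T : finType) (e : rel T) (h : rel T) (n : T -> T -> T -> bool).
Hypotheses (e_sym : symmetric e) (e_irr : irreflexive e).
Hypothesis parity : crossing_parity e h n.

Let h_tournament := parity.1.
Let n_swap := parity.2.

(** The winding number mod 2 of the triangle around [p]. The order of arguments matters: [n u w] and
    [n w u] may come from different arcs. *)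
Definition side (u v w p : T) : bool := n u v p (+) n v w p (+) n u w p.

(** Adding the parity identity of [pq] with the three sides, all terms at a vertex of the triangle
    cancel, as it lies on two sides. *)
Lemma side_edge (u v w p q : T) : e u v -> e v w -> e u w -> e p q ->
  p \notin [set u; v; w] -> q \notin [set u; v; w] -> side u v w p = side u v w q.
Proof.
move=> euv evw euw epq; rewrite !inE !negb_or -!andbA.
move=> /and3P[pu pv pw] /and3P[qu qv qw].
have neqC (a b : T) : a != b -> b != a by rewrite eq_sym.
have := n_swap euv epq; have := n_swap evw epq; have := n_swap euw epq.
rewrite ?(neqC p) ?(neqC q) //.
move=> /(_ isT isT isT isT)/addb_eq0 uw /(_ isT isT isT isT)/addb_eq0 vw.
move=> /(_ isT isT isT isT)/addb_eq0 uv; apply/addb_eq0.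
(* Each [false] is replaced by a vanishing sum, which leaves a polynomial identity mod 2. *)
rewrite -[RHS]/(addb (addb false false) false) -{1}uw -{1}vw -{1}uv.
rewrite /side; addb_ring.
Qed.

Lemma side_connect (S : {set T}) (u v w p q : T) : e u v -> e v w -> e u w ->
  S \subset ~: [set u; v; w] ->
  connect (induced_rel e S) p q -> side u v w p = side u v w q.
Proof.
move=> euv evw euw /subsetP SC.
move=> /connectP[s sp ->]; elim: s p sp => //= y s IH p /andP[/and3P[pS yS epy] ys].
rewrite -(IH _ ys); apply: side_edge => //.
  by have := SC _ pS; rewrite inE.
by have := SC _ yS; rewrite inE.
Qed.

(** In the cyclic order of edges at [u], starting from [uv], the triangle through the middle one of
    the three vertices separates the other two. *)
Lemma three_triangles_separate (u v w1 w2 w3 : T) :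
  uniq [:: u; v; w1; w2; w3] ->
  (forall w, w \in [:: w1; w2; w3] -> e u w /\ e v w) ->
  side u v w1 w2 = side u v w1 w3 ->
  side u v w2 w1 = side u v w2 w3 ->
  side u v w3 w1 = side u v w3 w2 -> False.
Proof.
rewrite /= !inE !negb_or -!andbA.
move=> /and5P[uv u1 u2 u3 /and5P[v1 v2 v3 w12 /and3P[w13 w23 _]]] adj.
have [eu1 ev1] : e u w1 /\ e v w1 by apply: adj; rewrite !inE eqxx.
have [eu2 ev2] : e u w2 /\ e v w2 by apply: adj; rewrite !inE eqxx ?orbT.
have [eu3 ev3] : e u w3 /\ e v w3 by apply: adj; rewrite !inE eqxx ?orbT.
have neqC (a b : T) : a != b -> b != a by rewrite eq_sym.
(* The right side has the form [1 + g i + g j]; over the three pairs every [g] occurs twice, leaving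
   [1 + 1 + 1]. *)
have pair i j : e u i -> e v i -> e u j -> e v j ->
    u != i -> v != i -> u != j -> v != j -> i != j ->
    (n u i j (+) n v j i) (+) (n u j i (+) n v i j) =
    ~~ ((n u i v (+) n v i u (+) h i v (+) h u i) (+)
        (n u j v (+) n v j u (+) h j v (+) h u j)).
  move=> eui evi euj evj ui vi uj vj ij.
  have := n_swap eui evj uv uj (neqC _ _ vi) ij.
  have := n_swap euj evi uv ui (neqC _ _ vj) (neqC _ _ ij).
  rewrite (h_tournament ij) => /addb_eq0 ji0 /addb_eq0 ij0; apply/addb_eq0.
  by rewrite -[RHS]/(addb false false) -{1}ji0 -ij0; addb_ring.
have /addb_eq0 p12 := pair w1 w2 eu1 ev1 eu2 ev2 u1 v1 u2 v2 w12.
have /addb_eq0 p13 := pair w1 w3 eu1 ev1 eu3 ev3 u1 v1 u3 v3 w13.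
have /addb_eq0 p23 := pair w2 w3 eu2 ev2 eu3 ev3 u2 v2 u3 v3 w23.
move=> /addb_eq0 s1 /addb_eq0 s2 /addb_eq0 s3.
suff : true = false by [].
(* The three equalities of sides sum to the same left sides, since each [n u v w_j] cancels; hence
   [1 = 0]. *)
transitivity (addb (addb false (addb false false)) (addb false (addb false false))) => //.
rewrite -{1}p12 -{1}p13 -{1}p23 -{1}s1 -{1}s2 -s3 /side; addb_ring.
Qed.

Lemma nonseparating_common_nbrs_le2 (S : {set T}) :
  (forall C, C \in kcliques_in e 3 S -> nonseparating_triangle e S C) ->
  forall u v, u \in S -> v \in S -> e u v -> #|[set w in S | e u w & e v w]| <= 2.
Proof.
move=> nosep u v uS vS euv; rewrite leqNgt; apply/negP=> /card_gt2P[w1 [w2 [w3]]].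
rewrite !inE => -[[/and3P[w1S eu1 ev1] /and3P[w2S eu2 ev2] /and3P[w3S eu3 ev3]]].
move=> [w12 w23 w31].
have neq x y : e x y -> x != y by apply: contraTneq => ->; rewrite e_irr.
(* The triangle [u v w] does not separate [S], so a path avoiding it joins [p] to [q]. *)
have same_side w p q : w \in S -> p \in S -> q \in S -> e u w -> e v w ->
    e u p -> e v p -> e u q -> e v q -> w != p -> w != q ->
    side u v w p = side u v w q.
  move=> wS pS qS euw evw eup evp euq evq wp wq.
  apply: (side_connect (S := S :\: [set u; v; w])) => //.
    by rewrite setDE subsetIr.
  have uvw_clique : [set u; v; w] \in kcliques_in e 3 S.
    rewrite !inE -setUA cardsU1 cards2 !inE negb_or !neq//= andbT.
    rewrite !subUset !sub1set uS vS wS !andbT; apply: is_clique_setU1 => //.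
      apply: is_clique_setU1 => //.
        by apply/is_cliqueP=> a b; rewrite !inE => /eqP-> /eqP->; rewrite eqxx.
      by move=> y; rewrite inE => /eqP->.
    by move=> y; rewrite !inE => /orP[]/eqP->.
  have /forall_inP/(_ p) := nosep _ uvw_clique.
  have notin x : x \in S -> e u x -> e v x -> w != x -> x \in S :\: [set u; v; w].
    move=> xS eux evx wx; rewrite !inE xS andbT !negb_or ![x == _]eq_sym.
    by rewrite (neq _ _ eux) (neq _ _ evx) wx.
  by move=> /(_ (notin p pS eup evp wp))/forall_inP/(_ q (notin q qS euq evq wq)).
apply: (three_triangles_separate (u := u) (v := v) (w1 := w1) (w2 := w2) (w3 := w3)) => //.
- rewrite /= !inE !negb_or (neq _ _ euv) (neq _ _ eu1) (neq _ _ eu2) (neq _ _ eu3).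
  by rewrite (neq _ _ ev1) (neq _ _ ev2) (neq _ _ ev3) w12 w23 (eq_sym w1 w3) w31.
- by move=> w; rewrite !inE => /or3P[]/eqP->.
- by apply: same_side => //; rewrite eq_sym.
- by apply: same_side => //; rewrite eq_sym.
- by apply: same_side => //; rewrite eq_sym.
Qed.
End CrossingParity.

Theorem theorem5 (T : finType) (e : rel T) :
  symmetric e -> irreflexive e -> planar e ->
  (3 <= #|edges e|)%N ->
  ((num_cliques e)%:R <= (#|T|)%:R + (7%:R / 3%:R) * (#|edges e|)%:R - 2%:R
     :> rat)%R.
Proof.
move=> e_sym e_irr /planar_crossing_parity[h [n parity]].
rewrite num_cliquesE edgesE// => m3.
have := card_cliques_in_le e_sym
  (nonseparating_common_nbrs_le2 e_sym e_irr parity) m3.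
rewrite cardsT -(ler_nat rat) natrD [X in (_ <= X)%R]natrD !natrM; lra.
Qed.
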